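(* For each integer $d\geq 2$ let $c(d)$ denote the competitive ratio of Algorithm OCS run with the function $f^*_d$ for online bipartite matching on $(d,d)$-bounded graphs. Then $\liminf_{d\to\infty}c(d)\geq 0.8976$.
   Context: Online bipartite matching: offline servers $S$, online requests $R$ arriving one at a time in adversarial order; on arrival of $r$ its neighbors are revealed and the algorithm irrevocably matches $r$ to an unmatched neighbor or leaves it unmatched. Competitive ratio on a class of instances: infimum of $\mathbb{E}[\mathsf{ALG}]/\mathsf{OPT}$, where $\mathsf{ALG}$ is the matching size and $\mathsf{OPT}$ the maximum matching size. A bipartite graph is $(k,d)$-bounded if every server has degree at least $k$ and every request has degree at most $d$. The function $f^*_d:\{0,1,\ldots\}\to\mathbb{R}$: $f^*_d(0)=1$ and $f^*_d(l)=f^*_d(l-1)\cdot\min_{1\leq m<d}\left(1+\frac{m f^*_d(l-1)}{d-m}\right)^{1/m}$ for $l\geq1$. Algorithm OCS (with function $f$): when request $r$ arrives, for each server $s$ let $l_s$ be the number of neighbors of $s$ that arrived before $r$; let $A$ be the set of unmatched neighbors of $r$; if $A\neq\emptyset$, match $r$ to $s\in A$ with probability $f(l_s)/\sum_{s'\in A}f(l_{s'})$. *)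

(* Defs.v *)
From HB Require Import structures.
From mathcomp Require Import all_boot all_order all_algebra.
From mathcomp Require Import all_classical all_reals all_analysis.
Set Implicit Arguments.
Unset Strict Implicit.
Unset Printing Implicit Defensive.
Import Order.TTheory GRing.Theory Num.Theory.
Local Open Scope ring_scope.

(* A finite bipartite graph together with an arrival order of its requests:
   the servers are 0, ..., nserver - 1; the requests are 0, ..., nreq - 1 and
   arrive in increasing order. *)
Record instance := Instance {
  nserver : nat;
  nreq : nat;
  adj : 'I_nserver -> 'I_nreq -> bool }.

Notation server I := 'I_(nserver I).
Notation request I := 'I_(nreq I).

Definition server_deg (I : instance) (s : server I) : nat :=
  #|[set r | adj s r]|.

Definition request_deg (I : instance) (r : request I) : nat :=
  #|[set s | adj s r]|.

Definition bounded_graph (k d : nat) (I : instance) : Prop :=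
  (forall s : server I, (k <= server_deg s)%N) /\
  (forall r : request I, (request_deg r <= d)%N).

Definition is_matching (I : instance) (M : {set server I * request I}) : bool :=
  [forall e in M, adj e.1 e.2] &&
  [forall e in M, forall e' in M,
     ((e.1 == e'.1) || (e.2 == e'.2)) ==> (e == e')].

Definition opt (I : instance) : nat :=
  (\max_(M : {set server I * request I} | is_matching M) #|M|)%N.

(* An outcome of an online algorithm: [w r] is the server to which [r] is
   matched, or [None] if [r] is left unmatched. *)
Definition outcome (I : instance) := {ffun request I -> option (server I)}.

Definition alg_size (I : instance) (w : outcome I) : nat :=
  #|[set r | w r != None]|.

Section OCS.
Variables (R : realType) (f : nat -> R) (I : instance).
Implicit Types (w : outcome I) (r : request I) (s : server I).

Definition arrived_before r s : nat :=
  #|[set r' : request I | adj s r' && (r' < r)%N]|.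

(* The set A; it depends on [w] only through the requests preceding [r]. *)
Definition available w r : {set server I} :=
  [set s | adj s r &&
     ~~ [exists r' : request I, (r' < r)%N && (w r' == Some s)]].

(* Conditional probability that the algorithm takes decision [o] for [r],
   given its decisions [w] for the requests preceding [r]. *)
Definition ocs_step w r (o : option (server I)) : R :=
  match o with
  | Some s => if s \in available w r
              then f (arrived_before r s) /
                   \sum_(s' in available w r) f (arrived_before r s')
              else 0
  | None => if available w r == finset.set0 then 1 else 0
  end.

(* The law of the outcome, by the chain rule. *)
Definition ocs_prob w : R := \prod_(r < nreq I) ocs_step w r (w r).

Definition ocs_expected_size : R :=
  \sum_(w : outcome I) ocs_prob w * (alg_size w)%:R.

End OCS.

(* Instances with [opt I = 0], for which the ratio is 0/0, are left out. *)
Definition competitive_ratio (R : realType) (expected_size : instance -> R)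
    (C : set instance) : R :=
  inf [set x : R | exists I : instance,
        [/\ C I, (0 < opt I)%N & x = expected_size I / (opt I)%:R]].

Definition fstar_factor (R : realType) (d : nat) (y : R) (m : nat) : R :=
  (1 + m%:R * y / (d%:R - m%:R)) `^ (m%:R^-1).

(* The default value of the minimum is its own term at m = 1, hence it is
   immaterial as soon as d >= 2. *)
Fixpoint fstar (R : realType) (d l : nat) : R :=
  match l with
  | 0%N => 1
  | l'.+1 =>
      fstar R d l' *
      \big[Num.min/fstar_factor d (fstar R d l') 1]_(1 <= m < d)
         fstar_factor d (fstar R d l') m
  end.

Definition ocs_ratio (R : realType) (d : nat) : R :=
  competitive_ratio (ocs_expected_size (fstar R d))
    [set I | bounded_graph d d I].

(* Main.v *)
Require Import Defs.
From mathcomp Require Import all_boot all_order all_algebra.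
From mathcomp Require Import all_classical all_reals all_analysis.
From mathcomp Require Import ring lra zify.
Set Implicit Arguments.
Unset Strict Implicit.
Unset Printing Implicit Defensive.
Import Order.TTheory GRing.Theory Num.Theory.
Import numFieldNormedType.Exports.
Local Open Scope ring_scope.

(* Whatever the graph, the probability that all the servers of a set [U] are
   still unmatched is at most the product over [U] of [1 / f l_s]: one arrival
   is handled by the concavity of [b / (c + b)] in the random weight [b] of the
   available servers outside [U], by the same bound for [U] plus one server, and
   by AM-GM, for which the recursion of [fstar] is tailored. Hence
   [c d >= 1 - 1 / fstar d d], and it remains to show that [fstar d d] is
   eventually at least [625 / 64 = 1 / (1 - 0.8976)].

   For large [d], [fstar] follows the differential equation [y' = y G(y)] with
   [G(y) = min_rho ln (1 + rho y / (1 - rho)) / rho]. The substitution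
   [s = rho G] turns this minimum into [G(y) = min_s (s + y s / (e^s - 1))], so
   that [G(y) = y] for [y <= 2], and [y] reaches [2] at time [1 / 2]; beyond
   that the minimizer [s] is a parameter of the curve, for which
   [d time / d s = (s coth (s / 2) - 2) / s^2]. The value [625 / 64] is reached
   near [s = 3.1526], at time about [0.99992 < 1]. *)

(** * Probability that a set of servers stays unmatched *)

Section PrefixProbability.
Variables (R : realType) (f : nat -> R) (I : instance).
Hypothesis f_gt0 : forall l, 0 < f l.
Implicit Types (w : outcome I) (r : request I) (s : server I).
Implicit Types (U : {set server I}) (o : option (server I)).

Definition arrived k s : nat := #|[set r : request I | adj s r && (r < k)%N]|.

Definition unmatched w k s : bool :=
  [forall r : request I, (r < k)%N ==> (w r != Some s)].

Definition set_decision w r o : outcome I :=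
  [ffun r' => if r' == r then o else w r'].

(* The decisions taken for the first [k] requests are encoded by the outcomes
   that leave all the later requests unmatched. *)
Definition prefix_outcomes k : {set outcome I} :=
  [set w : outcome I | [forall r : request I, (k <= r)%N ==> (w r == None)]].

Definition prefix_prob k w : R :=
  \prod_(r < nreq I | (r < k)%N) ocs_step f w r (w r).

Definition free_prob k U : R :=
  \sum_(w in prefix_outcomes k | [forall s in U, unmatched w k s]) prefix_prob k w.

Lemma availableE w r : available w r = [set s | adj s r & unmatched w r s].
Proof.
apply/setP => s; rewrite !inE; congr (_ && _).
rewrite negb_exists; apply: eq_forallb => r'.
by rewrite negb_and -implybE.
Qed.

Lemma eq_unmatched w w' k s :
  (forall r : request I, (r < k)%N -> w r = w' r) -> unmatched w k s = unmatched w' k s.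
Proof.
move=> ww'; apply: eq_forallb => r; case: ltnP => //= rk.
by rewrite ww'.
Qed.

Lemma eq_ocs_step w w' r o :
  (forall r' : request I, (r' < r)%N -> w r' = w' r') ->
  ocs_step f w r o = ocs_step f w' r o.
Proof.
move=> ww'; suff -> : ocs_step f w r o = ocs_step f w' r o by [].
have e : available w r = available w' r.
  by rewrite !availableE; apply/setP => s; rewrite !inE (eq_unmatched s ww').
by case: o => [s|] /=; rewrite e.
Qed.

Lemma sum_available_gt0 w r : available w r != finset.set0 ->
  0 < \sum_(s in available w r) f (arrived_before r s).
Proof.
case/set0Pn => s sA; rewrite (bigD1 s) //=.
by apply: ltr_wpDr; rewrite // sumr_ge0 // => i _; apply: ltW.
Qed.

Lemma ocs_step_ge0 w r o : 0 <= ocs_step f w r o.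
Proof.
case: o => [s|] /=; case: ifP => // _.
by rewrite divr_ge0 ?sumr_ge0 // => *; apply: ltW.
Qed.

Lemma sum_ocs_step w r : \sum_o ocs_step f w r o = 1.
Proof.
rewrite (bigD1 None) //= (reindex_omap Some id) /=; last by case.
have [A0|A0] := eqVneq (available w r) finset.set0.
  by rewrite big1 ?addr0 // => s _; rewrite A0 inE.
rewrite add0r (eq_bigl xpredT); last by move=> s; rewrite eqxx.
rewrite -big_mkcond /= -mulr_suml divff //.
by rewrite gt_eqF // sum_available_gt0.
Qed.

Lemma set_decision_lt w r o (r' : request I) :
  (r' < r)%N -> set_decision w r o r' = w r'.
Proof. by move=> lt; rewrite ffunE; case: eqP => // E; rewrite E ltnn in lt. Qed.

Lemma set_decision_same w r o : set_decision w r o r = o.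
Proof. by rewrite ffunE eqxx. Qed.

Lemma prefix_prob_ge0 k w : 0 <= prefix_prob k w.
Proof. by apply: prodr_ge0 => r _; apply: ocs_step_ge0. Qed.

Lemma prefix_prob_set_decision w r o :
  prefix_prob r.+1 (set_decision w r o) =
  prefix_prob r w * ocs_step f w r o.
Proof.
rewrite /prefix_prob (bigD1 r) //= mulrC set_decision_same; congr (_ * _).
  apply: eq_big => [r'|r' /andP[]]; first by rewrite ltnS ltn_neqAle andbC.
  rewrite ltnS => r'r nr'; have lt : (r' < r)%N by rewrite ltn_neqAle nr'.
  rewrite set_decision_lt //; apply: eq_ocs_step => r'' lt'.
  by rewrite set_decision_lt // (ltn_trans lt').
by apply: eq_ocs_step => r'; exact: set_decision_lt.
Qed.

(** Erasing the decision for [r] maps the outcomes decided up to and including [r] onto those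
    decided before [r]; each fibre is parametrized by the option taken for [r]. *)
Lemma sum_prefixS r (F : outcome I -> R) :
  \sum_(w in prefix_outcomes r.+1) F w =
  \sum_(w in prefix_outcomes r) \sum_o F (set_decision w r o).
Proof.
rewrite (partition_big (fun w => set_decision w r None) (mem (prefix_outcomes r))) /=.
  apply: eq_bigr => w0 w0P.
  rewrite (reindex_onto (set_decision w0 r) (fun w => w r)) /=; last first.
    move=> w /andP[_ /eqP <-]; apply/ffunP => r'; rewrite !ffunE.
    by case: eqP => // ->.
  apply: eq_bigl => o; rewrite set_decision_same eqxx andbT.
  move: w0P; rewrite !inE => /forallP w0P; apply/andP; split.
    apply/forallP => r'; apply/implyP => lt; rewrite ffunE.
    case: (r' =P r) => [E|_]; first by rewrite E ltnn in lt.
    exact: (implyP (w0P r') (ltnW lt)).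
  apply/eqP/ffunP => r'; rewrite !ffunE; case: eqP => // ->.
  by apply/esym/eqP; exact: (implyP (w0P r) (leqnn _)).
move=> w; rewrite !inE => /forallP wP; apply/forallP => r'.
apply/implyP => le; rewrite ffunE; case: (r' =P r) => // /eqP ne.
by apply: (implyP (wP r')); rewrite ltn_neqAle le andbT eq_sym.
Qed.

Lemma unmatched_set_decision w r o s :
  unmatched (set_decision w r o) r.+1 s = unmatched w r s && (o != Some s).
Proof.
apply/forallP/andP => [H|[/forallP H os] r'].
  split; last by have := H r; rewrite ltnSn set_decision_same.
  apply/forallP => r'; apply/implyP => lt.
  by have := H r'; rewrite ltnS ltnW //= set_decision_lt.
apply/implyP; rewrite ltnS leq_eqVlt => /orP[/eqP/val_inj ->|lt].
  by rewrite set_decision_same.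
by rewrite set_decision_lt //; exact: (implyP (H r') lt).
Qed.

(** Conditioning on the earlier decisions: [U] is free after [r] iff it was free before and [r]
    selects no server of [U]. *)
Lemma free_probS r U :
  free_prob r.+1 U =
  \sum_(w in prefix_outcomes r | [forall s in U, unmatched w r s])
     prefix_prob r w *
     \sum_(o | [forall s in U, o != Some s]) ocs_step f w r o.
Proof.
rewrite /free_prob big_mkcondr /= sum_prefixS [RHS]big_mkcondr /=.
apply: eq_bigr => w _; case: ifPn => [/forallP Uw|/forallPn [s]]; last first.
  rewrite negb_imply => /andP[sU nfr]; rewrite big1 // => o _.
  case: ifP => // /forallP /(_ s); rewrite sU unmatched_set_decision /=.
  by rewrite (negbTE nfr).
rewrite [X in _ * X]big_mkcond /= big_distrr /=; apply: eq_bigr => o _.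
rewrite prefix_prob_set_decision.
have -> : [forall s in U, unmatched (set_decision w r o) r.+1 s] =
          [forall s in U, o != Some s].
  apply: eq_forallb => s; rewrite unmatched_set_decision.
  by case: (boolP (s \in U)) (Uw s) => //= _ ->.
by case: ifP; rewrite ?mulr0.
Qed.

End PrefixProbability.

(** * The product bound, by induction on the arrivals *)

Section FreeProbabilityBound.
Variables (R : realType) (f : nat -> R) (I : instance) (d : nat).
Hypothesis f_gt0 : forall l, 0 < f l.
Hypothesis f0 : f 0%N = 1.
(** The recursion of [fstar] raised to the power [m], which removes the roots and suits AM-GM over
    [m] servers. *)
Hypothesis fS_le : forall l m, (0 < m < d)%N ->
  f l.+1 ^+ m <= f l ^+ m * (1 + m%:R * f l / (d%:R - m%:R)).
Hypothesis deg_le : forall r : request I, (request_deg r <= d)%N.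
Implicit Types (w : outcome I) (r : request I) (s : server I).
Implicit Types (U : {set server I}).

Let bound k U : R := \prod_(s in U) (f (arrived k s))^-1.

Let bound_ge0 k U : 0 <= bound k U.
Proof. by apply: prodr_ge0 => s _; rewrite invr_ge0 ltW. Qed.

Lemma arrivedS r s : arrived r.+1 s = (arrived r s + adj s r)%N.
Proof.
rewrite /arrived; have [a|na] := boolP (adj s r).
  rewrite [RHS]addnC.
  rewrite -[RHS](_ : #|r |: [set r' : request I | adj s r' && (r' < r)%N]| = _).
    apply: eq_card => r'; rewrite !inE ltnS leq_eqVlt (inj_eq val_inj).
    by case: eqP => // ->; rewrite a.
  by rewrite cardsU1 inE ltnn andbF.
rewrite addn0; apply: eq_card => r'; rewrite !inE ltnS leq_eqVlt andb_orr.
by rewrite (inj_eq val_inj); case: eqP => [->|_]; rewrite ?(negbTE na) ?andbF.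
Qed.

(* The tangent at [b = J] of the concave function [b / (c + b)]. *)
Lemma div_add_le_tangent (b c J : R) : 0 < c -> 0 <= b -> 0 <= J ->
  b / (c + b) <= (J ^+ 2 + c * b) / (c + J) ^+ 2.
Proof.
move=> c0 b0 J0; have cb : 0 < c + b by lra.
have cJ : 0 < (c + J) ^+ 2 by rewrite exprn_gt0 //; lra.
rewrite ler_pdivrMr // mulrAC ler_pdivlMr // -subr_ge0.
have -> : (J ^+ 2 + c * b) * (c + b) - b * (c + J) ^+ 2 = c * (J - b) ^+ 2.
  by ring.
by rewrite mulr_ge0 ?sqr_ge0 // ltW.
Qed.

(** Given a history [w] that leaves [U] free, [r] avoids [U] with probability [b / (c + b)], where
    [c] and [b] are the weights of the available servers inside and outside [U]. The tangent makes
    this linear in [b], so that it can be averaged over [w]. *)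
Lemma sum_unselected_le w r U (c J : R) :
  (forall s, s \in U -> unmatched w r s) -> (exists2 s, s \in U & adj s r) ->
  0 <= J ->
  c = \sum_(s in U | adj s r) f (arrived r s) ->
  \sum_(o | [forall s in U, o != Some s]) ocs_step f w r o <=
  (J ^+ 2 + c * \sum_(s | [&& s \notin U, adj s r & unmatched w r s])
                   f (arrived r s)) / (c + J) ^+ 2.
Proof.
move=> Ufree [s0 s0U s0r] J0 cE; set b := (X in _ + c * X).
have c0 : 0 < c.
  rewrite cE (bigD1 s0) ?s0U //=; apply: ltr_wpDr => //.
  by apply: sumr_ge0 => i _; exact: ltW.
have b0 : 0 <= b by apply: sumr_ge0 => i _; exact: ltW.
have s0A : s0 \in available w r by rewrite availableE inE s0r Ufree.
have An0 : available w r != finset.set0 by apply/set0Pn; exists s0.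
have Ab : \sum_(s in available w r) f (arrived_before r s) = c + b.
  rewrite cE (bigID (mem U)) /=; congr (_ + _).
    apply: eq_bigl => s; rewrite availableE inE.
    by case: (boolP (s \in U)) => [/Ufree ->|]; rewrite ?andbT ?andbF.
  by apply: eq_bigl => s; rewrite availableE inE andbC.
suff -> : \sum_(o | [forall s in U, o != Some s]) ocs_step f w r o = b / (c + b).
  exact: div_add_le_tangent.
rewrite (bigD1 None) /=; last by apply/forallP => s; apply/implyP.
rewrite (negbTE An0) add0r (reindex_omap Some id) /=; last by case=> // /andP[].
rewrite Ab /b mulr_suml big_mkcond [RHS]big_mkcond /=.
apply: eq_bigr => s _; rewrite eqxx !andbT availableE inE.
have -> : [forall s' in U, Some s != Some s'] = (s \notin U).
  apply/forallP/idP => [/(_ s)|sU s']; first by rewrite eqxx implybF.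
  by apply/implyP => s'U; apply: contraNneq sU => -[->].
by case: (s \notin U); case: (adj s r); case: unmatched.
Qed.

(** After linearization only the mean of [b] on the event that [U] is free matters. It is a sum over
    the neighbours [s] of [r] outside [U] of [f l_s] times the probability that [s |: U] is free. By
    [IH] each term is at most [bound r U], and there are at most [J] of them. With the tangent taken
    at [J], the bound collapses through [J ^+ 2 + c * J = J * (c + J)]. *)
Lemma free_probS_le r U (c J : R) :
  (forall V, free_prob f r V <= bound r V) ->
  (exists2 s, s \in U & adj s r) ->
  c = \sum_(s in U | adj s r) f (arrived r s) ->
  J = d%:R - #|[set s in U | adj s r]|%:R ->
  free_prob f r.+1 U <= bound r U * (J / (c + J)).
Proof.
move=> IH Ur cE JE; have [s0 s0U s0r] := Ur.
have cardN : #|[set s | adj s r]| = (#|[set s in U | adj s r]| +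
    #|[set s | (s \notin U) && adj s r]|)%N.
  rewrite -[LHS](cardsID U); congr (_ + _)%N; apply: eq_card => s; rewrite !inE andbC//.
have NU : #|[set s | (s \notin U) && adj s r]|%:R <= J.
  rewrite JE lerBrDl -natrD -cardN ler_nat; exact: deg_le.
have J0 : 0 <= J by apply: le_trans NU.
have c0 : 0 < c.
  rewrite cE (bigD1 s0) ?s0U //=; apply: ltr_wpDr => //.
  by apply: sumr_ge0 => i _; exact: ltW.
rewrite (free_probS _ r U).
pose b w := \sum_(s | [&& s \notin U, adj s r & unmatched w r s]) f (arrived r s).
apply: (@le_trans _ _
  (\sum_(w in prefix_outcomes I r | [forall s in U, unmatched w r s])
    prefix_prob f r w * ((J ^+ 2 + c * b w) / (c + J) ^+ 2))).
  apply: ler_sum => w /andP[_ /forallP Uw]; apply: ler_wpM2l.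
    exact: prefix_prob_ge0.
  by apply: sum_unselected_le => // s sU; have := Uw s; rewrite sU.
have sum_b : \sum_(w in prefix_outcomes I r | [forall s in U, unmatched w r s])
    prefix_prob f r w * b w <= J * bound r U.
  have -> : \sum_(w in prefix_outcomes I r | [forall s in U, unmatched w r s])
      prefix_prob f r w * b w =
      \sum_(s | (s \notin U) && adj s r) f (arrived r s) * free_prob f r (s |: U).
    under eq_bigr => w _ do rewrite /b big_distrr /=.
    rewrite (exchange_big_dep (fun s => (s \notin U) && adj s r)) /=; last first.
      by move=> w s _ /and3P[-> ->].
    apply: eq_bigr => s /andP[sU sr]; rewrite big_distrr /=.
    apply: eq_big => [w|w _]; last by rewrite mulrC.
    rewrite sU sr /= -andbA; congr (_ && _).
    apply/andP/forallP => [[/forallP H fs] s'|H].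
      apply/implyP; rewrite in_setU1 => /orP[/eqP -> //|s'U].
      by have := H s'; rewrite s'U.
    split; last by have := H s; rewrite setU11.
    apply/forallP => s'; apply/implyP => s'U.
    by have := H s'; rewrite in_setU1 s'U orbT.
  apply: (@le_trans _ _ (\sum_(s | (s \notin U) && adj s r) bound r U)).
    apply: ler_sum => s /andP[sU _]; have := IH (s |: U).
    rewrite /bound big_setU1 //= => H.
    apply: le_trans (ler_wpM2l (ltW (f_gt0 _)) H) _.
    by rewrite mulrA divff ?mul1r // gt_eqF.
  rewrite sumr_const -mulr_natl; apply: ler_wpM2r; first exact: bound_ge0.
  by apply: le_trans NU; rewrite cardsE.
have -> : \sum_(w in prefix_outcomes I r | [forall s in U, unmatched w r s])
    prefix_prob f r w * ((J ^+ 2 + c * b w) / (c + J) ^+ 2) =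
  (J ^+ 2 * free_prob f r U +
   c * \sum_(w in prefix_outcomes I r | [forall s in U, unmatched w r s])
     prefix_prob f r w * b w) / (c + J) ^+ 2.
  rewrite /free_prob !big_distrr /= -big_split /= big_distrl /=.
  by apply: eq_bigr => w _; ring.
have cJ : 0 < c + J by lra.
have -> : bound r U * (J / (c + J)) =
    (J ^+ 2 * bound r U + c * (J * bound r U)) / (c + J) ^+ 2.
  by field; rewrite gt_eqF.
apply: ler_wpM2r; first by rewrite invr_ge0 exprn_ge0 // ltW.
apply: lerD; first by apply: ler_wpM2l; [exact: exprn_ge0|exact: IH].
by apply: ler_wpM2l => //; exact: ltW.
Qed.

(** Both sides are raised to the power [#|M|]: [fS_le] with [m = #|M|] bounds each factor by [E s],
    and AM-GM bounds the product of the [E s] by the power of their mean, which is the right-hand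
    side. *)
Lemma prod_growth_le (M : {set server I}) (l : server I -> nat) (J : R) :
  (0 < #|M| < d)%N -> J = d%:R - #|M|%:R ->
  \prod_(s in M) (f (l s).+1 / f (l s)) <= 1 + (\sum_(s in M) f (l s)) / J.
Proof.
move=> /andP[M0 Md] JE.
have J0 : 0 < J by rewrite JE subr_gt0 ltr_nat.
have m0 : 0 < #|M|%:R :> R by rewrite ltr0n.
pose E s : R := 1 + #|M|%:R * f (l s) / J.
have E0 s : 0 <= E s.
  by rewrite addr_ge0 // divr_ge0 ?mulr_ge0 // ltW.
have sum0 : 0 <= \sum_(s in M) f (l s) by apply: sumr_ge0 => s _; exact: ltW.
rewrite -(@ler_pXn2r _ #|M|) ?nnegrE //; last 2 first.
- by apply: prodr_ge0 => s _; rewrite divr_ge0 // ltW.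
- by rewrite addr_ge0 // divr_ge0 // ltW.
apply: (@le_trans _ _ (\prod_(s in M) E s)).
  rewrite -prodrXl; apply: ler_prod => s _; apply/andP; split.
    by rewrite exprn_ge0 // divr_ge0 // ltW.
  rewrite expr_div_n ler_pdivrMr ?exprn_gt0 // mulrC /E JE.
  by apply: fS_le; rewrite M0.
have /leifP := leif_AGM (fun s (_ : s \in M) => E0 s).
have -> : (\sum_(s in M) E s) / #|M|%:R = 1 + (\sum_(s in M) f (l s)) / J.
  rewrite /E big_split /= sumr_const -mulr_suml -mulr_sumr.
  by field; rewrite !gt_eqF.
by case: ifP => _; [move=> /eqP ->|move/ltW].
Qed.

Lemma free_prob_le k U : (k <= nreq I)%N -> free_prob f k U <= bound k U.
Proof.
elim: k U => [|k IH] U kn.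
  have -> : bound 0%N U = 1.
    rewrite /bound big1 // => s _; rewrite /arrived.
    have -> : [set r : request I | adj s r && (r < 0)%N] = finset.set0.
      by apply/setP => r; rewrite !inE andbF.
    by rewrite cards0 f0 invr1.
  rewrite /free_prob (eq_bigl (pred1 [ffun=> None])) ?big_pred1_eq.
    by rewrite /prefix_prob big_pred0_eq.
  move=> w; rewrite inE /=; apply/andP/eqP => [[/forallP H _]|->].
    by apply/ffunP => r; rewrite ffunE; apply/eqP; have := H r.
  split; first by apply/forallP => r; rewrite ffunE.
  by apply/forallP => s; apply/implyP => _; apply/forallP => r; rewrite ffunE.
have [r rk] : exists r : request I, val r = k by exists (Ordinal kn).
rewrite -{k}rk in IH kn *.
have {}IH V : free_prob f r V <= bound r V by apply: IH; exact: ltnW.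
pose M := [set s in U | adj s r].
(* If [r] has no neighbour in [U], the bound does not change and the probability that [U] is free
   cannot increase. *)
have [M0|Mn0] := eqVneq M finset.set0.
  have nadj s : s \in U -> adj s r = false.
    move=> sU; have : s \notin M by rewrite M0 inE.
    by rewrite inE sU => /negbTE.
  have -> : bound r.+1 U = bound r U.
    by apply: eq_bigr => s sU; rewrite arrivedS nadj ?addn0.
  apply: le_trans (IH U); rewrite free_probS; apply: ler_sum => w _.
  rewrite -[leRHS]mulr1; apply: ler_wpM2l; first exact: prefix_prob_ge0.
  rewrite -(sum_ocs_step f_gt0 w r).
  rewrite [leRHS](bigID (fun o => [forall s in U, o != Some s])) /=.
  by rewrite lerDl; apply: sumr_ge0 => o _; exact: ocs_step_ge0.
have Ur : exists2 s, s \in U & adj s r.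
  by have /set0Pn[s] := Mn0; rewrite inE => /andP[]; exists s.
apply: le_trans (free_probS_le IH Ur erefl erefl) _; set c := \sum_(s in U | _) _.
have Mle : (#|M| <= d)%N.
  apply: leq_trans (deg_le r); apply: subset_leq_card.
  by apply/fintype.subsetP => s; rewrite !inE => /andP[].
have Mgt0 : (0 < #|M|)%N by rewrite card_gt0.
have -> : bound r.+1 U =
    bound r U * (\prod_(s in M) (f (arrived r s).+1 / f (arrived r s)))^-1.
  rewrite /bound [LHS](bigID (fun s => adj s r)) [in RHS](bigID (fun s => adj s r)) /=.
  rewrite [RHS]mulrAC -[X in _ * X * _]prodfV; congr (_ * _); last first.
    by apply: eq_bigr => s /andP[_ /negbTE na]; rewrite arrivedS na addn0.
  rewrite [X in _ * X](eq_bigl (fun s => (s \in U) && adj s r)) => [|s];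
    last by rewrite inE.
  rewrite -big_split /=; apply: eq_bigr => s /andP[_ a]; rewrite arrivedS a addn1.
  by rewrite invf_div mulrA mulVf ?mul1r // gt_eqF.
apply: ler_wpM2l; first exact: bound_ge0.
have P0 : 0 < \prod_(s in M) (f (arrived r s).+1 / f (arrived r s)).
  by apply: prodr_gt0 => s _; rewrite divr_gt0.
(* If [d] neighbours of [r] lie in [U], then [r] has no other neighbour: [J = 0] and the left-hand
   side vanishes. *)
have [Md|dM] := ltnP #|M| d; last first.
  have -> : d = #|M| by apply/eqP; rewrite eqn_leq Mle dM.
  by rewrite subrr mul0r invr_ge0 ltW.
have J0 : 0 < d%:R - #|M|%:R :> R by rewrite subr_gt0 ltr_nat.
have cE : c = \sum_(s in M) f (arrived r s).
  by apply: eq_bigl => s; rewrite inE.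
have c0 : 0 <= c by apply: sumr_ge0 => s _; exact: ltW.
rewrite -/M; move: J0; set J := _ - _ => J0.
rewrite -[X in X <= _]invrK lef_pV2 ?posrE //; last first.
  by rewrite invr_gt0 divr_gt0 //; lra.
have -> : (J / (c + J))^-1 = 1 + c / J.
  by field; rewrite !gt_eqF //; lra.
by rewrite cE; apply: prod_growth_le; rewrite // Mgt0.
Qed.

End FreeProbabilityBound.

(** * Expected size of the matching *)

Section ExpectedSize.
Variables (R : realType) (f : nat -> R) (I : instance) (d : nat).
Hypothesis f_gt0 : forall l, 0 < f l.
Hypothesis f0 : f 0%N = 1.
Hypothesis f_ndecr : forall l, f l <= f l.+1.
Hypothesis fS_le : forall l m, (0 < m < d)%N ->
  f l.+1 ^+ m <= f l ^+ m * (1 + m%:R * f l / (d%:R - m%:R)).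
Implicit Types (w : outcome I) (s : server I).

Lemma prefix_outcomes_full w : w \in prefix_outcomes I (nreq I).
Proof. by rewrite inE; apply/forallP => r; rewrite leqNgt ltn_ord. Qed.

Lemma prefix_prob_full w : prefix_prob f (nreq I) w = ocs_prob f w.
Proof. by apply: eq_bigl => r; rewrite ltn_ord. Qed.

Lemma sum_prefix_prob k : (k <= nreq I)%N ->
  \sum_(w in prefix_outcomes I k) prefix_prob f k w = 1.
Proof.
elim: k => [_|k IH kn].
  rewrite (eq_bigl (pred1 [ffun=> None])) ?big_pred1_eq.
    by rewrite /prefix_prob big_pred0_eq.
  move=> w; rewrite inE /=; apply/forallP/eqP => [H|-> r]; last by rewrite ffunE.
  by apply/ffunP => r; rewrite ffunE; apply/eqP; have := H r.
have [r rk] : exists r : request I, val r = k by exists (Ordinal kn).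
rewrite -{k}rk in IH kn *; rewrite sum_prefixS -[RHS](IH (ltnW kn)).
apply: eq_bigr => w _; under eq_bigr do rewrite prefix_prob_set_decision.
by rewrite -big_distrr /= sum_ocs_step // mulr1.
Qed.

(** Every matched server is the image under [w] of some matched request. *)
Lemma alg_size_ge w :
  (nserver I - #|[set s | unmatched w (nreq I) s]| <= alg_size w)%N.
Proof.
rewrite leq_subLR -[X in (X <= _)%N]card_ord -(cardsC [set s | unmatched w (nreq I) s]).
have Some_inj' : injective (@Some (server I)) by move=> s s' [].
rewrite leq_add2l -(card_imset _ Some_inj').
apply: leq_trans (leq_imset_card w _); apply: subset_leq_card.
apply/fintype.subsetP => o /imsetP[s]; rewrite !inE => /forallPn[r].
rewrite negb_imply negbK => /andP[_ /eqP wr] ->.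
by apply/imsetP; exists r; rewrite ?inE wr.
Qed.

(** Linearity of expectation over the servers, with [free_prob_le] applied to singletons at the end
    of the arrivals. *)
Lemma ocs_expected_size_ge : bounded_graph d d I ->
  (nserver I)%:R * (1 - (f d)^-1) <= ocs_expected_size f I.
Proof.
move=> [sdeg rdeg].
apply: (@le_trans _ _ (\sum_(w : outcome I) ocs_prob f w *
    ((nserver I)%:R - \sum_(s : server I) (unmatched w (nreq I) s)%:R))); last first.
  apply: ler_sum => w _; apply: ler_wpM2l.
    by rewrite -prefix_prob_full prefix_prob_ge0.
  rewrite -natr_sum lerBlDl -natrD ler_nat -leq_subLR.
  apply: leq_trans (alg_size_ge w).
  apply: leq_sub2l; rewrite -sum1dep_card big_mkcond /=.
  by apply: leq_sum => s _; case: unmatched.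
have -> : \sum_(w : outcome I) ocs_prob f w *
    ((nserver I)%:R - \sum_(s : server I) (unmatched w (nreq I) s)%:R) =
  (nserver I)%:R - \sum_(s : server I) free_prob f (nreq I) [set s].
  under eq_bigr do rewrite mulrBr.
  rewrite sumrB -mulr_suml; congr (_ - _).
    rewrite -[RHS]mul1r -(sum_prefix_prob (leqnn _)); congr (_ * _).
    by apply: eq_big => w; rewrite ?prefix_outcomes_full ?prefix_prob_full.
  under eq_bigr do rewrite big_distrr /=.
  rewrite exchange_big /=; apply: eq_bigr => s _.
  rewrite /free_prob [RHS]big_mkcond /=; apply: eq_bigr => w _.
  rewrite prefix_outcomes_full prefix_prob_full /=.
  have -> : [forall s' in [set s], unmatched w (nreq I) s'] = unmatched w (nreq I) s.
    apply/forallP/idP => [/(_ s)|us s']; first by rewrite inE eqxx.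
    by rewrite inE; apply/implyP => /eqP ->.
  by case: unmatched; rewrite ?mulr1 ?mulr0.
rewrite mulrBr mulr1 lerD2l lerN2 mulr_natl -[X in _ *+ X]card_ord -sumr_const.
apply: ler_sum => s _.
apply: le_trans (free_prob_le f_gt0 f0 fS_le rdeg [set s] (leqnn _)) _.
rewrite big_set1 lef_pV2 ?posrE //.
have -> : arrived (nreq I) s = server_deg s.
  by apply: eq_card => r; rewrite !inE ltn_ord andbT.
(* The degree of [s] may exceed [d]; monotonicity of [f] brings the bound back to [f d]. *)
move: (sdeg s); elim: (server_deg s) => [|n IHn]; first by rewrite leqn0 => /eqP ->.
by rewrite leq_eqVlt => /orP[/eqP -> //|/IHn]; move/le_trans; apply.
Qed.

End ExpectedSize.

(** * From the recursion of [fstar] to the competitive ratio *)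

Lemma opt_le_nserver (I : instance) : (opt I <= nserver I)%N.
Proof.
apply/bigmax_leqP => M /andP[_ /forallP Mm].
rewrite -[X in (_ <= X)%N]card_ord -(card_in_imset (f := fst)) ?max_card //.
move=> e e' eM e'M E; have := Mm e; rewrite eM => /forallP /(_ e').
by rewrite e'M E eqxx => /eqP.
Qed.

Section Fstar.
Variables (R : realType) (d : nat).
Local Notation f := (fstar R d).

Lemma fstar_factor_ge1 (y : R) m : 0 <= y -> (0 < m < d)%N ->
  1 <= fstar_factor d y m.
Proof.
move=> y0 /andP[m0 md]; rewrite /fstar_factor.
rewrite -[leLHS](powRr0 (1 + m%:R * y / (d%:R - m%:R))).
have J0 : 0 < d%:R - m%:R :> R by rewrite subr_gt0 ltr_nat.
by apply: ler_powR; rewrite ?invr_ge0 // lerDl divr_ge0 ?mulr_ge0 // ltW.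
Qed.

Lemma fstarS_ge (c : R) l : (2 <= d)%N -> 0 <= f l ->
  (forall m, (0 < m < d)%N -> c <= fstar_factor d (f l) m) ->
  f l * c <= f l.+1.
Proof.
move=> d2 f0 H /=; apply: ler_wpM2l => //.
rewrite big_nat; apply: le_bigmin => [|m]; last exact: H.
by apply: H; rewrite d2.
Qed.

Lemma fstar_ge1 l : (2 <= d)%N -> 1 <= f l.
Proof.
move=> d2; elim: l => [|l IH] //; have f0 : 0 <= f l by apply: le_trans IH.
apply: le_trans IH _; rewrite -[leLHS]mulr1; apply: fstarS_ge => // m md.
exact: fstar_factor_ge1.
Qed.

Lemma fstar_ndecr l : (2 <= d)%N -> f l <= f l.+1.
Proof.
move=> d2; have f0 : 0 <= f l by apply: le_trans (fstar_ge1 l d2).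
rewrite -[leLHS]mulr1; apply: fstarS_ge => // m md.
exact: fstar_factor_ge1.
Qed.

Lemma fstarS_exp_le l m : (0 < m < d)%N ->
  f l.+1 ^+ m <= f l ^+ m * (1 + m%:R * f l / (d%:R - m%:R)).
Proof.
move=> md; have /andP[m0 ltmd] := md; have d2 : (2 <= d)%N by apply: leq_ltn_trans ltmd.
have f0 k : 0 <= f k by apply: le_trans (fstar_ge1 k d2).
have J0 : 0 < d%:R - m%:R :> R by rewrite subr_gt0 ltr_nat.
have E0 : 0 <= 1 + m%:R * f l / (d%:R - m%:R).
  by rewrite addr_ge0 // divr_ge0 ?mulr_ge0 // ltW.
have -> : 1 + m%:R * f l / (d%:R - m%:R) = fstar_factor d (f l) m ^+ m.
  rewrite /fstar_factor -powR_mulrn ?powR_ge0 // -powRrM mulVf ?powRr1 //.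
  by rewrite pnatr_eq0 -lt0n.
rewrite -exprMn lerXn2r ?nnegrE ?f0 ?mulr_ge0 ?powR_ge0 //=.
apply: ler_wpM2l => //; apply: ge_bigmin_seq => //.
by rewrite mem_index_iota.
Qed.

End Fstar.

Lemma ocs_ratio_ge (R : realType) d : (2 <= d)%N ->
  1 - (fstar R d d)^-1 <= ocs_ratio R d.
Proof.
move=> d2; have d0 : (0 < d)%N by apply: ltnW.
have f_gt0 l : 0 < fstar R d l by apply: lt_le_trans (fstar_ge1 R l d2).
apply: lb_le_inf.
  (* The set of ratios has to be nonempty for its infimum to be bounded below by a lower bound; the
     complete bipartite graph with [d] vertices on each side supplies an element. *)
  pose I := Instance (fun (_ : 'I_d) (_ : 'I_d) => true).
  exists (ocs_expected_size (fstar R d) I / (opt I)%:R), I; split => //.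
    split => s; rewrite /server_deg /request_deg.
      by rewrite (eq_card (B := predT)) ?card_ord // => r; rewrite !inE.
    by rewrite (eq_card (B := predT)) ?card_ord // => r; rewrite !inE.
  pose e : server I * request I := (Ordinal d0, Ordinal d0).
  apply: leq_trans (leq_bigmax_cond [set e] _) => /=; first by rewrite cards1.
  apply/andP; split; first by apply/forallP => x; apply/implyP.
  apply/forallP => x; apply/implyP; rewrite inE => /eqP ->.
  by apply/forallP => y; apply/implyP; rewrite inE => /eqP ->; rewrite eqxx.
move=> _ [I [bI opt0 ->]]; rewrite ler_pdivlMr ?ltr0n //.
apply: le_trans (ocs_expected_size_ge f_gt0 _ _ _ bI) => //; last 2 first.
- by move=> l; exact: fstar_ndecr.
- by move=> l m; exact: fstarS_exp_le.
rewrite mulrC; apply: ler_wpM2r; last by rewrite ler_nat opt_le_nserver.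
by rewrite subr_ge0 invf_le1 // fstar_ge1.
Qed.

Lemma limn_einf_ge (R : realType) (u : nat -> \bar R) (c : \bar R) N :
  (forall n, (N <= n)%N -> (c <= u n)%E) -> (c <= limn_einf u)%E.
Proof.
move=> H; rewrite limn_einf_lim; apply: lime_ge; first exact: is_cvg_einfs.
exists N => // n /= Nn; apply: le_ereal_inf_tmp => _ [k /= nk <-].
by apply: H; apply: leq_trans nk.
Qed.

(** * Bounds on the hyperbolic cotangent *)

Lemma is_derive_ndecr (R : realType) (f df : R -> R) (a b : R) :
  (forall x, a <= x <= b -> is_derive x 1 f (df x)) ->
  (forall x, a <= x <= b -> 0 <= df x) -> a <= b -> f a <= f b.
Proof.
move=> fdf df0 ab.
have der x : x \in `]a, b[%R -> is_derive x 1 f (df x).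
  by rewrite in_itv /= => /andP[/ltW ? /ltW ?]; apply: fdf; apply/andP.
have cont : {within `[a, b], continuous f}%classic.
  apply: derivable_within_continuous => x; rewrite in_itv /= => xab.
  by have [] := fdf x xab.
have [c cab E] := MVT_segment ab der cont.
by rewrite -subr_ge0 E mulr_ge0 ?subr_ge0 // df0 // -in_itv.
Qed.

Section HyperbolicRemainders.
Variable R : realType.
Implicit Type x : R.

(* Remainders of the continued fraction
   [x coth x = 1 + x^2 / (3 + x^2 / (5 + ...))]; each of them is the integral of
   [x] times the previous one. *)
Fixpoint coth_rem (n : nat) x : R :=
  match n with
  | 0%N => (expR x - (expR x)^-1) / 2
  | n'.+1 =>
      match n' with
      | 0%N => x * ((expR x + (expR x)^-1) / 2) - (expR x - (expR x)^-1) / 2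
      | n''.+1 => x ^+ 2 * coth_rem n'' x - (2 * n''%:R + 3) * coth_rem n' x
      end
  end.

Lemma coth_remSS n x : coth_rem n.+2 x =
  x ^+ 2 * coth_rem n x - (2 * n%:R + 3) * coth_rem n.+1 x.
Proof. by []. Qed.

Lemma is_derive_coth_rem n x :
  is_derive x 1 (coth_rem n.+1) (x * coth_rem n x).
Proof.
have e0 y : expR y != 0 :> R by rewrite gt_eqF ?expR_gt0.
(* The recurrence has order two, so two consecutive indices are carried through the induction. *)
suff : is_derive x 1 (coth_rem n.+1) (x * coth_rem n x) /\
       is_derive x 1 (coth_rem n.+2) (x * coth_rem n.+1 x) by case.
elim: n => [|n [IH1 IH2]]; split => //.
- rewrite /coth_rem; have := e0 x => ex0; apply: is_derive_eq.
  by rewrite /GRing.scale /=; field.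
- have d0 : is_derive x 1 (coth_rem 0) ((expR x + (expR x)^-1) / 2).
    rewrite /coth_rem; have := e0 x => ex0; apply: is_derive_eq.
    by rewrite /GRing.scale /=; field.
  have d1 : is_derive x 1 (coth_rem 1) (x * coth_rem 0 x).
    rewrite /coth_rem; have := e0 x => ex0; apply: is_derive_eq.
    by rewrite /GRing.scale /=; field.
  rewrite (funext (coth_remSS 0)).
  by apply: is_derive_eq; rewrite /GRing.scale /=; field; exact: e0.
- rewrite (funext (coth_remSS n.+1)); apply: is_derive_eq.
  rewrite /GRing.scale coth_remSS.
  by rewrite -(natr1 n); move: (coth_rem n x) (coth_rem n.+1 x) => u v /=; ring.
Qed.

(** Each remainder vanishes at [0], and its derivative is [x] times the previous one. *)
Lemma coth_rem_ge0 n x : 0 <= x -> 0 <= coth_rem n x.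
Proof.
have at0 k : coth_rem k 0 = 0.
  suff : coth_rem k 0 = 0 /\ coth_rem k.+1 0 = 0 by case.
  elim: k => [|k [IH1 IH2]].
    by rewrite /= expR0 invr1; split; ring.
  by split=> //; rewrite coth_remSS IH1 IH2; ring.
elim: n x => [|n IH] x x0.
  rewrite /= divr_ge0 // subr_ge0 -expRN ler_expR; lra.
rewrite -(at0 n.+1); apply: is_derive_ndecr (fun y _ => is_derive_coth_rem n y) _ x0.
by move=> y /andP[y0 _]; rewrite mulr_ge0 // IH.
Qed.

Lemma coth_rem0E x : coth_rem 0 x * (2 * expR x) = expR (2 * x) - 1.
Proof.
rewrite expRM_natl /=; have := expR_gt0 x => a0; field; exact: lt0r_neq0.
Qed.

Lemma coth_rem1E x :
  coth_rem 1 x * (2 * expR x) = x * (expR (2 * x) + 1) - (expR (2 * x) - 1).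
Proof.
rewrite expRM_natl /=; have := expR_gt0 x => a0; field; exact: lt0r_neq0.
Qed.

(** Equivalent to [t coth (t / 2) >= 2], which is [coth_rem 1 >= 0] at [t / 2]. *)
Lemma expR_pade_le (t : R) : 0 <= t -> (2 - t) * expR t <= 2 + t.
Proof.
move=> t0; have t2 : 0 <= t / 2 by apply: divr_ge0.
have := mulr_ge0 (coth_rem_ge0 1 t2) (mulr_ge0 (ler0n R 2) (expR_ge0 (t / 2))).
by rewrite coth_rem1E [2 * (t / 2)]mulrC divfK //; lra.
Qed.

(* The Taylor polynomial of [(t coth (t / 2) - 2) / t ^ 2], with a smaller last
   coefficient, chosen so that it is an upper bound for [t ^ 2 <= 10]. *)
Definition rate_poly (t : R) : R :=
  6^-1 - t ^+ 2 / 360 + t ^+ 4 / (120 * 126) - t ^+ 6 / (840 * 936).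

(** The antiderivative of [rate_poly] that vanishes at [0]: for [t ^+ 2 <= 10], an upper bound for
    the time spent on the curve between the parameters [0] and [t]. *)
Definition time_poly (t : R) : R :=
  t / 6 - t ^+ 3 / 1080 + t ^+ 5 / (270 * 280) - t ^+ 7 / (1080 * 5096).

(** With [x = t / 2], [coth_rem 4 x >= 0] says that [x coth x - 1] is at most the convergent
    [x^2 (x^2 + 35) / (10 x^2 + 105)], which is then compared with [rate_poly]. *)
Lemma coth_rate_le (t : R) : 0 <= t -> t ^+ 2 <= 10 ->
  t * (expR t + 1) - 2 * (expR t - 1) <= t ^+ 2 * rate_poly t * (expR t - 1).
Proof.
move=> t0 t10; pose x := t / 2; have x0 : 0 <= x by apply: divr_ge0.
have tE : t = 2 * x by rewrite /x; field.
have u0 := coth_rem_ge0 0 x0; have u4 := coth_rem_ge0 4 x0.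
have {u4} u1 : (10 * x ^+ 2 + 105) * coth_rem 1 x <=
    x ^+ 2 * (x ^+ 2 + 35) * coth_rem 0 x.
  rewrite -subr_ge0; apply: le_trans u4 _.
  rewrite le_eqVlt; apply/orP; left; apply/eqP.
  by rewrite (coth_remSS 2) (coth_remSS 1) (coth_remSS 0);
    move: (coth_rem 0 x) (coth_rem 1 x) => u v; ring.
have s10 : x ^+ 2 <= 5 / 2 by move: t10; rewrite tE exprMn; lra.
have pE : 2 * rate_poly t = 3^-1 - x ^+ 2 / 45 + 2 / 945 * x ^+ 4 * (1 - x ^+ 2 / 13).
  by rewrite /rate_poly tE; field.
have u1' : coth_rem 1 x <= x ^+ 2 * (2 * rate_poly t) * coth_rem 0 x.
  have c0 : 0 < 10 * x ^+ 2 + 105 by have := sqr_ge0 x; lra.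
  rewrite -(ler_pM2l c0); apply: le_trans u1 _.
  move: (coth_rem 0 x) u0 => u u0.
  rewrite [leRHS](_ : _ = x ^+ 2 * ((10 * x ^+ 2 + 105) * (2 * rate_poly t)) * u);
    last by ring.
  apply: (ler_wpM2r u0); apply: ler_wpM2l; first exact: sqr_ge0.
  rewrite pE -subr_ge0.
  (* The factor [5 - 2 * x ^+ 2] is where [t ^+ 2 <= 10] enters. *)
  have -> : (10 * x ^+ 2 + 105) *
      (3^-1 - x ^+ 2 / 45 + 2 / 945 * x ^+ 4 * (1 - x ^+ 2 / 13)) - (x ^+ 2 + 35) =
    (2 / 9) * x ^+ 6 * ((5 - 2 * x ^+ 2) / 273) by field.
  by apply: mulr_ge0; [apply: mulr_ge0; [lra|exact: exprn_ge0]|lra].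
have a0 : 0 < 2 * expR x by rewrite mulr_gt0 ?expR_gt0.
move: u1'; rewrite -(ler_pM2r a0) coth_rem1E -(mulrA _ (coth_rem 0 x)) coth_rem0E -tE.
by rewrite tE; move: (rate_poly _) => p; lra.
Qed.

Lemma is_derive_time_poly (t : R) : is_derive t 1 time_poly (rate_poly t).
Proof.
have D (a b c e : R) : is_derive t 1
    (fun t => t * a - t ^+ 3 * b + t ^+ 5 * c - t ^+ 7 * e)
    (a - 3 * t ^+ 2 * b + 5 * t ^+ 4 * c - 7 * t ^+ 6 * e).
  by apply: is_derive_eq; rewrite /GRing.scale /=; ring.
have := D 6^-1 1080^-1 (270 * 280)^-1 (1080 * 5096)^-1.
move=> H; apply: is_derive_eq; rewrite /rate_poly.
by field.
Qed.

Lemma time_poly_ndecr (s t : R) : 0 <= s -> t ^+ 2 <= 10 -> s <= t ->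
  time_poly s <= time_poly t.
Proof.
move=> s0 t10 st; apply: (is_derive_ndecr (fun x _ => is_derive_time_poly x) _ st).
move=> x /andP[sx xt]; rewrite /rate_poly.
have u10 : x ^+ 2 <= 10.
  apply: le_trans t10; rewrite lerXn2r ?nnegrE //.
    exact: le_trans sx.
  exact: le_trans st.
have u0 : 0 <= x ^+ 2 by apply: sqr_ge0.
have -> : x ^+ 4 = (x ^+ 2) ^+ 2 by ring.
have -> : x ^+ 6 = (x ^+ 2) ^+ 2 * x ^+ 2 by ring.
move: (x ^+ 2) u0 u10 => u u0 u10.
have : u ^+ 2 * u <= u ^+ 2 * 10 by rewrite ler_wpM2l ?sqr_ge0.
have := sqr_ge0 u.
lra.
Qed.

End HyperbolicRemainders.

(** * The limiting differential equation *)

Section TangentCurve.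
Variable R : realType.
Implicit Types s t x : R.

(* [growth_ok g y] says that [g <= min_rho ln (1 + rho y / (1 - rho)) / rho],
   in terms of [s = g rho]. *)
Definition growth_ok (g y : R) : Prop :=
  forall s, 0 < s -> (g - s) * (expR s - 1) <= s * y.

(** The claim rearranges to [y (e^s - 1 - s) <= s (e^s - 1)]; the extreme case [y = 2] is
    [expR_pade_le]. *)
Lemma growth_ok_small y : y <= 2 -> growth_ok y y.
Proof.
move=> y2 s s0; have e1 := expR_ge1Dx s; have e2 := expR_pade_le (ltW s0).
have : 0 <= (2 - y) * (expR s - 1 - s) by rewrite mulr_ge0; lra.
lra.
Qed.

Lemma growth_ok_expR g y (rho : R) : 0 < g -> growth_ok g y -> 0 < rho < 1 ->
  expR (g * rho) <= 1 + rho * y / (1 - rho).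
Proof.
move=> g0 gy /andP[r0 r1]; have := gy (g * rho) (mulr_gt0 g0 r0).
have -> : g - g * rho = g * (1 - rho) by ring.
move=> H; rewrite -!mulrA ler_pM2l // in H.
have J0 : 0 < 1 - rho by lra.
by rewrite -lerBlDl ler_pdivlMr // mulrC.
Qed.

(** Minus the numerator of the derivative of [t / (e^t - 1)]. *)
Definition tan_den t : R := t * expR t - expR t + 1.

(* By strict convexity of [s / (expR s - 1)], the minimum over [s] of
   [s + s y / (expR s - 1)] is attained at [s = t] for [y = tan_val t], and it
   equals [tan_rate t]. *)
Definition tan_val t : R := (expR t - 1) ^+ 2 / tan_den t.
Definition tan_rate t : R := t ^+ 2 * expR t / tan_den t.

Lemma expR_gt1_sub t : 0 < t -> 0 < expR t - 1.
Proof. by move=> t0; rewrite subr_gt0 expR_gt1. Qed.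

Lemma tan_den_gt0 t : 0 < t -> 0 < tan_den t.
Proof.
move=> t0; have e0 := expR_gt0 t.
have : 1 - t < expR (- t) by apply: expR_gt1Dx; rewrite oppr_eq0 gt_eqF.
rewrite expRN -(ltr_pM2r e0) mulVf ?gt_eqF // /tan_den; lra.
Qed.

Lemma tan_val_gt0 t : 0 < t -> 0 < tan_val t.
Proof. by move=> t0; rewrite divr_gt0 ?exprn_gt0 ?expR_gt1_sub ?tan_den_gt0. Qed.

Lemma tan_rate_gt0 t : 0 < t -> 0 < tan_rate t.
Proof.
by move=> t0; rewrite divr_gt0 ?mulr_gt0 ?exprn_gt0 ?expR_gt0 ?tan_den_gt0.
Qed.

(** The reciprocal of the rate is [(x - 1 + e^(-x)) / x^2], and the sign of its derivative is again
    given by [expR_pade_le]. *)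
Lemma tan_rate_ndecr s t : 0 < s -> s <= t -> tan_rate s <= tan_rate t.
Proof.
move=> s0 st; have t0 := lt_le_trans s0 st.
pose h x : R := - ((x - 1 + expR (- x)) / x ^+ 2).
have hE x : 0 < x -> h x = - (tan_rate x)^-1.
  move=> x0; have e0 := expR_gt0 x; have d0 := tan_den_gt0 x0.
  rewrite /h /tan_rate expRN; move: d0; rewrite /tan_den => d0.
  by field; rewrite !gt_eqF.
rewrite -(lef_pV2 (x := tan_rate t)) ?posrE ?tan_rate_gt0 // -lerN2 -!hE //.
apply: (@is_derive_ndecr _ h
  (fun x => ((2 + x) * expR (- x) - (2 - x)) / x ^+ 3) _ _ _ _ st) => x /andP[sx _].
  have x0 : x != 0 by rewrite gt_eqF // (lt_le_trans s0).
  have xx0 : x ^+ 2 != 0 by rewrite expf_neq0.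
  by rewrite /h; apply: is_derive_eq; rewrite /GRing.scale /=; field.
have x0 : 0 < x by apply: lt_le_trans sx.
rewrite divr_ge0 ?exprn_ge0 ?(ltW x0) // expRN subr_ge0.
rewrite -(ler_pM2r (expR_gt0 x)) mulfVK ?gt_eqF ?expR_gt0 //.
exact: expR_pade_le (ltW x0).
Qed.

(** The differential equation along the curve: [ln y] grows at rate [tan_rate] in time, and the
    second factor is the derivative of time, [(t coth (t / 2) - 2) / t^2]. *)
Lemma is_derive_ln_tan_val t : 0 < t ->
  is_derive t 1 (fun x => ln (expR x - 1) *+ 2 - ln (tan_den x))
    (tan_rate t * ((t * (expR t + 1) - 2 * (expR t - 1)) /
       (t ^+ 2 * (expR t - 1)))).
Proof.
move=> t0; have a0 := expR_gt1_sub t0; have d0 := tan_den_gt0 t0.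
have l1 := is_derive1_ln a0; have l2 := is_derive1_ln d0.
move: l2 d0; rewrite /tan_rate /tan_den => l2 d0.
apply: is_derive_eq; rewrite /GRing.scale /=.
by field; rewrite !gt_eqF.
Qed.

Lemma tan_valE t : 0 < t ->
  tan_val t = expR (ln (expR t - 1) *+ 2 - ln (tan_den t)).
Proof.
move=> t0; have a0 := expR_gt1_sub t0; have d0 := tan_den_gt0 t0.
by rewrite expRD expRN mulr2n expRD !lnK ?posrE.
Qed.

Lemma tan_val_ndecr s t : 0 < s -> s <= t -> tan_val s <= tan_val t.
Proof.
move=> s0 st; have t0 := lt_le_trans s0 st.
rewrite (tan_valE s0) (tan_valE t0) ler_expR.
have gt0 x : s <= x <= t -> 0 < x by case/andP => sx _; apply: lt_le_trans sx.
apply: (is_derive_ndecr (fun x sxt => is_derive_ln_tan_val (gt0 x sxt)) _ st).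
move=> x /gt0 x0.
rewrite mulr_ge0 ?(ltW (tan_rate_gt0 x0)) // divr_ge0 //.
  by have := expR_pade_le (ltW x0); lra.
by rewrite mulr_ge0 ?exprn_ge0 ?(ltW x0) ?(ltW (expR_gt1_sub x0)).
Qed.

(** On the whole interval the rate is at most its final value [tan_rate t], and the derivative of
    time is at most [rate_poly]. *)
Lemma tan_val_le s t : 0 < s -> s <= t -> t ^+ 2 <= 10 ->
  tan_val t <= tan_val s * expR (tan_rate t * (time_poly t - time_poly s)).
Proof.
move=> s0 st t10; have t0 := lt_le_trans s0 st.
rewrite (tan_valE s0) (tan_valE t0) -expRD ler_expR.
pose L x : R := ln (expR x - 1) *+ 2 - ln (tan_den x).
have gt0 x : s <= x <= t -> 0 < x by case/andP => sx _; apply: lt_le_trans sx.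
suff : tan_rate t * time_poly s - L s <= tan_rate t * time_poly t - L t.
  by rewrite -/(L s) -/(L t); lra.
apply: (@is_derive_ndecr _ (fun x => tan_rate t * time_poly x - L x)
  (fun x => tan_rate t * rate_poly x -
    tan_rate x * ((x * (expR x + 1) - 2 * (expR x - 1)) /
       (x ^+ 2 * (expR x - 1)))) _ _ _ _ st) => x sxt; have x0 := gt0 x sxt.
  have d1 := is_derive_time_poly x; have d2 := is_derive_ln_tan_val x0.
  rewrite -/(L) in d2.
  by apply: is_derive_eq; rewrite /GRing.scale /=; ring.
have a0 := expR_gt1_sub x0; have /andP[sx xt] := sxt.
have x10 : x ^+ 2 <= 10.
  by apply: le_trans t10; rewrite lerXn2r ?nnegrE ?(ltW x0) ?(ltW t0).
rewrite subr_ge0; apply: ler_pM; [exact: ltW (tan_rate_gt0 _)| |exact: tan_rate_ndecr|].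
  rewrite divr_ge0 //; first by have := expR_pade_le (ltW x0); lra.
  by rewrite mulr_ge0 ?exprn_ge0 ?(ltW x0) ?(ltW a0).
rewrite ler_pdivrMr ?mulr_gt0 ?exprn_gt0 //.
by apply: le_trans (coth_rate_le (ltW x0) x10) _; rewrite mulrA [rate_poly x * _]mulrC.
Qed.

(** The function [h] to be minimized has derivative [1 - tan_val t / tan_val x], which changes sign
    at [x = t] since [tan_val] is nondecreasing. *)
Lemma growth_ok_tan t : 0 < t -> growth_ok (tan_rate t) (tan_val t).
Proof.
move=> t0 s s0.
pose h x : R := x * tan_val t / (expR x - 1) + x.
pose dh x : R := 1 - tan_val t / tan_val x.
have der x : 0 < x -> is_derive x 1 h (dh x).
  move=> x0; have a0 := expR_gt1_sub x0; have d0 := tan_den_gt0 x0.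
  have an0 : expR x - 1 != 0 by rewrite gt_eqF.
  rewrite /h /dh /(tan_val x); move: (tan_val t) d0 => y; rewrite /tan_den => d0.
  by apply: is_derive_eq; rewrite /GRing.scale /=; field; rewrite !gt_eqF.
have ht : h t = tan_rate t.
  rewrite /h /tan_val /tan_rate; have a0 := expR_gt1_sub t0.
  have := tan_den_gt0 t0; rewrite /tan_den => d0.
  by field; rewrite !gt_eqF.
have : tan_rate t <= h s.
  rewrite -ht; have [ts|/ltW st] := leP t s.
    have gt0 x : t <= x <= s -> 0 < x by case/andP => tx _; apply: lt_le_trans tx.
    apply: (is_derive_ndecr (fun x tx => der x (gt0 x tx)) _ ts) => x /andP[tx _].
    have x0 := lt_le_trans t0 tx.
    by rewrite subr_ge0 ler_pdivrMr ?tan_val_gt0 // mul1r tan_val_ndecr.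
  rewrite -lerN2.
  apply: (@is_derive_ndecr _ (fun x => - h x) (fun x => - dh x) _ _ _ _ st);
    move=> x /andP[sx xt].
    have x0 := lt_le_trans s0 sx; have := der x x0 => dx.
    by apply: is_derive_eq.
  have x0 := lt_le_trans s0 sx.
  by rewrite oppr_ge0 subr_le0 ler_pdivlMr ?tan_val_gt0 // mul1r tan_val_ndecr.
have a0 := expR_gt1_sub s0.
by rewrite /h -lerBlDr ler_pdivlMr.
Qed.

(** Bounds the loss when the rate at the left end of a mesh interval [[t, q t]] replaces the rate at
    its right end. With [a = e^t] and [k = e^((q - 1) t)], it reduces to
    [1 - (q - 1) (a - 1) <= 1 / k], where both sides are compared with [1 - (q - 1) t]. *)
Lemma tan_rate_scale q t : 1 <= q -> 0 < t -> tan_rate (q * t) <= q * tan_rate t.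
Proof.
move=> q1 t0; have q0 : 0 < q by lra.
have d0 := tan_den_gt0 t0; have d1 := tan_den_gt0 (mulr_gt0 q0 t0).
rewrite /tan_rate ler_pdivrMr // [X in _ <= X * _]mulrA [leRHS]mulrAC ler_pdivlMr //.
have -> : (q * t) ^+ 2 * expR (q * t) * tan_den t =
  (q * t ^+ 2) * (q * expR (q * t) * tan_den t) by ring.
have -> : q * (t ^+ 2 * expR t) * tan_den (q * t) =
  (q * t ^+ 2) * (expR t * tan_den (q * t)) by ring.
apply: ler_wpM2l; first by rewrite mulr_ge0 ?exprn_ge0 ?(ltW t0) ?(ltW q0).
rewrite /tan_den.
have -> : q * t = t + (q - 1) * t by ring.
rewrite expRD; have a1 := expR_ge1Dx t.
have k1 := expR_ge1Dx (- ((q - 1) * t)); rewrite expRN in k1.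
have k0 := expR_gt0 ((q - 1) * t); have a0 := expR_gt0 t.
move: (expR t) (expR ((q - 1) * t)) k0 k1 a0 a1 => a k k0 k1 a0 a1.
have H : k * (q - q * a + a) <= 1.
  have : q - q * a + a <= k^-1.
    have : 0 <= (q - 1) * (a - 1 - t) by rewrite mulr_ge0; lra.
    lra.
  by rewrite -(ler_pM2l k0) divff // gt_eqF.
have : 0 <= a * (1 - k * (q - q * a + a)) by rewrite mulr_ge0 //; lra.
lra.
Qed.

(* Sharp as [t] tends to [0], where [tan_val t] tends to [2]. *)
Lemma tan_val_le_expR t : 0 < t -> tan_val t <= 2 * expR t.
Proof.
move=> t0; have d0 := tan_den_gt0 t0; rewrite /tan_val ler_pdivrMr // -subr_ge0.
pose h x : R := 2 * x - 3 + 4 * expR (- x) - expR (- x) ^+ 2.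
have : h 0 <= h t.
  apply: (@is_derive_ndecr _ h (fun x => 2 * (1 - expR (- x)) ^+ 2)
    _ _ _ _ (ltW t0)) => x _.
  - by rewrite /h; apply: is_derive_eq; rewrite /GRing.scale /=; ring.
  - by rewrite mulr_ge0 ?sqr_ge0.
rewrite {1}/h oppr0 expR0 => h0; have e0 := expR_gt0 t.
have -> : 2 * expR t * tan_den t - (expR t - 1) ^+ 2 = expR t ^+ 2 * h t.
  by rewrite /tan_den /h expRN; field; rewrite gt_eqF.
by rewrite mulr_ge0 ?sqr_ge0 //; lra.
Qed.

End TangentCurve.

(** * Growth of [fstar] *)

Lemma expR_ge_taylor (R : realType) (x : R) n : 0 <= x ->
  \sum_(0 <= k < n) x ^+ k / k`!%:R <= expR x.
Proof.
move=> x0; apply: nondecreasing_cvgn_le; last exact: is_cvg_series_exp_coeff.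
apply/nondecreasing_seqP => k; rewrite /series /= big_nat_recr //= lerDl.
by rewrite /exp_coeff /= divr_ge0 ?exprn_ge0.
Qed.

Section FstarGrowth.
Variables (R : realType) (d : nat).
Hypothesis d2 : (2 <= d)%N.
Local Notation f := (fstar R d).

Lemma growth_ok_le (g y y' : R) : y <= y' -> growth_ok g y -> growth_ok g y'.
Proof. by move=> yy' gy s s0; apply: le_trans (gy s s0) _; rewrite ler_pM2l. Qed.

(** One arrival is a time step [1 / d]; the term [m] of the minimum corresponds to [rho = m / d]. *)
Lemma fstarS_expR g l : 0 < g -> growth_ok g (f l) ->
  f l * expR (g / d%:R) <= f l.+1.
Proof.
move=> g0 gf; have f0 : 0 <= f l by apply: le_trans (fstar_ge1 R l d2).
apply: fstarS_ge => // m /andP[m0 md].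
have mR : 0 < m%:R :> R by rewrite ltr0n.
have dR : 0 < d%:R :> R by rewrite ltr0n ltnW.
have J0 : 0 < d%:R - m%:R :> R by rewrite subr_gt0 ltr_nat.
have -> : g / d%:R = (g * (m%:R / d%:R)) * m%:R^-1.
  by field; rewrite !gt_eqF.
rewrite expRM; apply: ge0_ler_powR.
- by rewrite invr_ge0 ltW.
- by rewrite nnegrE expR_ge0.
- by rewrite nnegrE addr_ge0 // divr_ge0 ?mulr_ge0 // ltW.
have := growth_ok_expR (rho := m%:R / d%:R) g0 gf; move=> /(_ _)/le_trans; apply.
  by rewrite divr_gt0 //= ltr_pdivrMr // mul1r ltr_nat.
rewrite le_eqVlt; apply/orP; left; apply/eqP.
by field; rewrite !gt_eqF.
Qed.

(** A rate admissible at [y] stays admissible above [y], and [f] is nondecreasing. *)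
Lemma fstar_expR g y l n : 0 < g -> growth_ok g y -> y <= f l ->
  y * expR (g * n%:R / d%:R) <= f (l + n)%N.
Proof.
move=> g0 gy yf; have mono k : f l <= f (l + k)%N.
  elim: k => [|k IH]; first by rewrite addn0.
  by rewrite addnS; apply: le_trans IH _; exact: fstar_ndecr.
elim: n => [|n IH]; first by rewrite mulr0 mul0r expR0 mulr1 addn0.
have gfn : growth_ok g (f (l + n)) by apply: growth_ok_le gy; apply: le_trans (mono n).
rewrite addnS; apply: le_trans (fstarS_expR g0 gfn).
rewrite -natr1 mulrDr mulrDl expRD mulr1 mulrA.
by apply: ler_wpM2r; rewrite ?expR_ge0.
Qed.

(* While [fstar] is at most [2], the differential equation is [y' = y ^ 2]. *)
Lemma fstar_ge_hyperbola l : (l <= d./2 + 2)%N ->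
  (d%:R + 2) / (d%:R + 2 - l%:R) <= f l.
Proof.
have dR : 2 <= d%:R :> R by rewrite ler_nat.
elim: l => [_|l IH ld]; first by rewrite subr0 divff //; lra.
have {}IH := IH (ltnW ld).
have l2 : 2 * l%:R <= d%:R + 2 :> R.
  rewrite -natrM -natrD ler_nat; have := odd_double_half d; lia.
have J0 : 0 < d%:R + 2 - l%:R :> R by lra.
set z := _ / _ in IH.
have z0 : 0 < z by rewrite divr_gt0 //; lra.
have z2 : z <= 2 by rewrite ler_pdivrMr //; lra.
have := fstar_expR 1 z0 (growth_ok_small z2) IH.
rewrite mulr1 addn1; apply: le_trans.
apply: (@le_trans _ _ (z * (1 + z / d%:R))); last first.
  by apply: ler_wpM2l; [exact: ltW | exact: expR_ge1Dx].
rewrite -[l.+1%:R]natr1 -subr_ge0 /z.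
(* The shift from [d] to [d + 2] slows the hyperbola enough for the discrete step to keep up with it
   as long as [2 l <= d + 2]. *)
have -> : (d%:R + 2) / (d%:R + 2 - l%:R) * (1 + (d%:R + 2) / (d%:R + 2 - l%:R) / d%:R) -
  (d%:R + 2) / (d%:R + 2 - (l%:R + 1)) =
  (d%:R + 2) * (d%:R + 2 - 2 * l%:R) /
   ((d%:R + 2 - l%:R) ^+ 2 * d%:R * (d%:R + 2 - (l%:R + 1))) :> R.
  by field; rewrite !gt_eqF //; lra.
rewrite divr_ge0 // !mulr_ge0 ?sqr_ge0 //; lra.
Qed.

Lemma fstar_half_ge2 : 2 <= f (d./2 + 2)%N.
Proof.
apply: le_trans (fstar_ge_hyperbola (leqnn _)).
have := odd_double_half d; set h := d./2 => dE.
have dh : (2 * h <= d <= (2 * h).+1)%N by lia.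
have /andP[h1 h2] : (2 * h%:R <= d%:R :> R) && (d%:R <= 2 * h%:R + 1 :> R).
  by rewrite -natrM natr1 !ler_nat.
rewrite natrD ler_pdivlMr; first by lra.
have : 2 <= d%:R :> R by rewrite ler_nat.
by lra.
Qed.

(** The curve is followed on the geometric mesh [t0 * q ^+ i], at constant rate on each interval.
    The factor [q] pays for freezing the rate, by [tan_rate_scale], and the summand [i] for rounding
    to a whole number of steps on each interval. *)
Lemma fstar_ge_tan (q t0 : R) l : 1 <= q -> 0 < t0 -> tan_val t0 <= f l ->
  forall i n, (t0 * q ^+ i) ^+ 2 <= 10 ->
  d%:R * (q * (time_poly (t0 * q ^+ i) - time_poly t0)) + i%:R <= n%:R ->
  tan_val (t0 * q ^+ i) <= f (l + n)%N.
Proof.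
move=> q1 t00 tl; have q0 : 0 < q by apply: lt_le_trans q1.
have dR : 0 < d%:R :> R by rewrite ltr0n ltnW.
have mono k n : (k <= n)%N -> f k <= f n.
  elim: n => [|n IH]; first by rewrite leqn0 => /eqP ->.
  rewrite leq_eqVlt => /orP[/eqP -> //|/IH/le_trans]; apply.
  exact: fstar_ndecr.
elim=> [|i IH] n tq nge.
  by rewrite expr0 mulr1; apply: le_trans tl _; apply: mono; rewrite leq_addr.
set s := t0 * q ^+ i in IH *; have s0 : 0 < s by rewrite mulr_gt0 ?exprn_gt0.
have tE : t0 * q ^+ i.+1 = q * s by rewrite exprSr /s; ring.
rewrite tE in tq nge *.
have sq : s <= q * s by rewrite ler_peMl // ltW.
have s10 : s ^+ 2 <= 10.
  by apply: le_trans tq; rewrite lerXn2r ?nnegrE ?(ltW s0) // ltW // mulr_gt0.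
have t0s : t0 <= s by rewrite ler_peMr ?(ltW t00) // exprn_ege1.
have Pt0 := time_poly_ndecr (ltW t00) s10 t0s.
pose x := d%:R * (q * (time_poly s - time_poly t0)) + i%:R.
have x0 : 0 <= x.
  by rewrite addr_ge0 // !mulr_ge0 ?(ltW dR) ?(ltW q0) // subr_ge0.
have /andP[xn nx] := truncn_itv x0; set n1 := (Num.truncn x).+1 in nx.
have n1x : n1%:R <= x + 1 by rewrite /n1 -natr1 lerD2r.
have Ps := time_poly_ndecr (ltW s0) tq sq.
have step0 : 0 <= d%:R * (q * (time_poly (q * s) - time_poly s)).
  by rewrite !mulr_ge0 ?(ltW dR) ?(ltW q0) // subr_ge0.
(* [n1] steps reach the mesh point [s]; the remaining [n - n1] suffice for the last interval. *)
have gap : d%:R * (q * (time_poly (q * s) - time_poly s)) <= n%:R - n1%:R.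
  by move: nge n1x; rewrite /x -[i.+1%:R]natr1; lra.
have n1n : (n1 <= n)%N by rewrite -(ler_nat R); lra.
have {}IH := IH n1 s10 (ltW nx).
rewrite -(subnKC n1n) addnA.
apply: le_trans (fstar_expR (n - n1) (tan_rate_gt0 s0) (growth_ok_tan s0) IH).
apply: le_trans (tan_val_le s0 sq tq) _.
apply: ler_wpM2l; first exact: ltW (tan_val_gt0 s0).
rewrite ler_expR natrB // -mulrA.
apply: (@le_trans _ _ (q * tan_rate s * (time_poly (q * s) - time_poly s))).
  by apply: ler_wpM2r; [rewrite subr_ge0|exact: tan_rate_scale].
rewrite mulrAC mulrC; apply: ler_wpM2l; first exact: ltW (tan_rate_gt0 s0).
by rewrite ler_pdivlMr // mulrC.
Qed.

End FstarGrowth.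

(** * Numerical evaluation and the choice of the mesh *)

Section Numerics.
Variable R : realType.

(* Slightly more than the parameter at which [tan_val] is [625 / 64]. *)
Definition end_point : R := 3 + 763 / 5000.

Lemma end_point_sq_le : end_point ^+ 2 <= 10.
Proof. by rewrite /end_point; lra. Qed.

(** Half of the unit of time is spent on reaching [2]; the slack pays for the mesh and the starting
    point. *)
Lemma time_poly_end : time_poly end_point <= 1 / 2 - 1 / (500 * 100).
Proof. by rewrite /time_poly /end_point; lra. Qed.

Lemma expR_end_ge : 7323 / 313 <= expR end_point.
Proof.
(* Division by [8] makes a Taylor polynomial of degree [6] accurate enough; the eighth power undoes
   it. *)
pose x : R := end_point / 8.
have c : 611 / 412 <= expR x.
  apply: le_trans (expR_ge_taylor 7 _); last by rewrite /x /end_point; lra.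
  rewrite !big_nat_recr //= big_nil /x /end_point !factS fact0; lra.
have -> : end_point = x * 8%:R by rewrite /x divfK.
rewrite expRM_natr; apply: (@le_trans _ _ ((611 / 412) ^+ 8)); first by lra.
apply: lerXn2r c; rewrite nnegrE; first lra.
exact: expR_ge0.
Qed.

Lemma tan_val_end : 625 / 64 <= tan_val end_point.
Proof.
have t0 : 0 < end_point by rewrite /end_point; lra.
rewrite ler_pdivlMr ?tan_den_gt0 // /tan_den; have := expR_end_ge.
move: (expR end_point) => a ar; rewrite /end_point.
(* Replaces [a ^+ 2] by its tangent at [7323 / 313], which leaves an inequality linear in [a]. *)
have := sqr_ge0 (a - 7323 / 313).
lra.
Qed.

Lemma exists_expn_ge (h K : R) : 0 < h -> exists n, K <= (1 + h) ^+ n.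
Proof.
move=> h0; have bern n : 1 + n%:R * h <= (1 + h) ^+ n.
  elim: n => [|n IH]; first by rewrite mul0r addr0 expr0.
  rewrite exprSr; apply: (@le_trans _ _ ((1 + n%:R * h) * (1 + h))).
    rewrite -natr1; have : 0 <= n%:R * h * h by rewrite !mulr_ge0 // ltW.
    lra.
  by apply: ler_wpM2r IH; lra.
exists (Num.truncn (K / h)).+1; apply: le_trans (bern _).
have : K / h <= (Num.truncn (K / h)).+1%:R by apply/ltW/truncnS_gt.
by rewrite ler_pdivrMr //; lra.
Qed.

Lemma natr_half_le d : (d./2)%:R <= d%:R / 2 :> R.
Proof.
rewrite ler_pdivlMr // -natrM ler_nat muln2.
by rewrite -[leqRHS]odd_double_half leq_addl.
Qed.

(** Three phases: [d./2 + 2] steps to reach [2], then [n2] steps at the constant rate [2] to reach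
    [tan_val t0], then the mesh from [t0] to [end_point]. *)
Lemma fstar_diag_ge : exists D, forall d, (D <= d)%N -> 625 / 64 <= fstar R d d.
Proof.
pose q : R := 1 + (10 ^+ 6)^-1.
have q1 : 1 <= q by rewrite /q; lra.
have h0 : 0 < (10 ^+ 6)^-1 :> R by lra.
have [N qN] := exists_expn_ge (10 ^+ 6) h0; rewrite -/q in qN.
have end0 : 0 < end_point by rewrite /end_point; lra.
have qN0 : 0 < q ^+ N by apply: lt_le_trans qN; lra.
(* The mesh ends exactly at [end_point], and [N] is large enough for the middle phase to take only
   about [d t0 / 2 <= 2 d / 10^6] steps. *)
pose t0 := end_point / q ^+ N.
have t00 : 0 < t0 by rewrite divr_gt0.
have t0E : t0 * q ^+ N = end_point by rewrite divfK // gt_eqF.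
have t0le : t0 <= 4 / 10 ^+ 6.
  rewrite ler_pdivrMr //; apply: (@le_trans _ _ (4 / 10 ^+ 6 * 10 ^+ 6)).
    by rewrite /end_point; lra.
  by apply: ler_wpM2l qN; lra.
have Pt0 : 0 <= time_poly t0.
  have -> : 0 = time_poly 0 :> R by rewrite /time_poly !expr0n /=; ring.
  apply: time_poly_ndecr => //; last exact: ltW.
  by have : t0 * t0 <= 1 * 1; [apply: ler_pM; lra|rewrite expr2; lra].
have qP : q * (time_poly end_point - time_poly t0) <= 1 / 2 - 15 / 10 ^+ 6.
  apply: (@le_trans _ _ (q * (1 / 2 - 1 / (500 * 100)))).
    apply: ler_wpM2l; first lra.
    by have := time_poly_end; lra.
  by rewrite /q; lra.
(* Rounding costs at most [N + 3] steps in all, while the time slack left is [(15 - 2) d / 10^6]. *)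
exists (Num.truncn ((N%:R + 3) * 10 ^+ 5 : R)).+2 => d Dd.
have d2 : (2 <= d)%N by apply: leq_trans Dd.
have dR : 0 < d%:R :> R by rewrite ltr0n ltnW.
have dge : (N%:R + 3) * 10 ^+ 5 <= d%:R :> R.
  apply/ltW/(lt_le_trans (truncnS_gt _)); rewrite ler_nat.
  by apply: leq_trans Dd.
pose x : R := d%:R * t0 / 2.
have x0 : 0 <= x by rewrite divr_ge0 // mulr_ge0 // ltW.
have /andP[xn nx] := truncn_itv x0; set n2 := (Num.truncn x).+1 in nx.
have n2x : n2%:R <= x + 1 by rewrite /n2 -natr1 lerD2r.
have start : tan_val t0 <= fstar R d (d./2 + 2 + n2).
  have y2 : growth_ok (2 : R) 2 by apply: growth_ok_small.
  apply: le_trans (fstar_expR d2 n2 _ y2 (fstar_half_ge2 R d2)) => //.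
  apply: le_trans (tan_val_le_expR t00) _; apply: ler_wpM2l => //.
  by rewrite ler_expR ler_pdivlMr //; move: nx; rewrite /x; lra.
have half := natr_half_le d.
have xle : x <= d%:R * (2 / 10 ^+ 6).
  by rewrite /x -mulrA; apply: ler_wpM2l; lra.
have qPd : d%:R * (q * (time_poly end_point - time_poly t0)) <=
    d%:R * (1 / 2 - 15 / 10 ^+ 6) by apply: ler_wpM2l; lra.
have small : (d./2 + 2 + n2)%:R +
    (d%:R * (q * (time_poly end_point - time_poly t0)) + N%:R) <= d%:R.
  by rewrite !natrD; lra.
have le : (d./2 + 2 + n2 <= d)%N.
  rewrite -(ler_nat R); apply: le_trans small.
  have Pe : time_poly t0 <= time_poly end_point.
    apply: time_poly_ndecr (ltW t00) end_point_sq_le _.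
    by rewrite -t0E ler_peMr ?(ltW t00) // exprn_ege1.
  rewrite lerDl addr_ge0 // !mulr_ge0 ?(ltW dR) //; lra.
apply: le_trans tan_val_end _; rewrite -[X in fstar R d X](subnKC le) -t0E.
apply: (fstar_ge_tan d2 q1 t00 start); rewrite t0E; first exact: end_point_sq_le.
by rewrite natrB //; lra.
Qed.

End Numerics.

Theorem theorem4p9 (R : realType) :
  ((8976 / 10000 : R)%:E <= limn_einf (fun d : nat => (ocs_ratio R d)%:E))%E.
Proof.
have [D HD] := fstar_diag_ge R.
apply: (@limn_einf_ge _ _ _ (maxn 2 D)) => d; rewrite geq_max => /andP[d2 Dd].
rewrite lee_fin; apply: le_trans (ocs_ratio_ge R d2).
have fd := HD d Dd; have f0 : 0 < fstar R d d by apply: lt_le_trans fd; lra.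
have r0 : 0 < 625 / 64 :> R by lra.
have : (fstar R d d)^-1 <= (625 / 64)^-1 by rewrite lef_pV2 ?posrE ?f0 ?r0 ?fd.
lra.
Qed.
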